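(* Consider the following search problem. An unknown multiset $S$ of $k$ integers, each in $\{1,\dots,n\}$, is fixed. An algorithm repeatedly chooses a query $Y\in\{1,\dots,n\}$ (possibly adaptively, based on previous answers); each time, an element $X$ of $S$ is selected uniformly at random, independently of everything else, and the algorithm is told only whether $X\le Y$ or $X>Y$. For $k\le n$ and any $\delta\in(0,1)$, there is an algorithm that finds all $k$ integers in $S$ using $O\!\left(k^3\log\frac{n}{\delta}\right)$ queries, with probability of error at most $\delta$.
   Context: Queries are the only cost measure (''time'' refers to the number of queries). *)

(* Defs.v *)
From HB Require Import structures.
From mathcomp Require Import all_boot all_order all_algebra.
From mathcomp Require Import finmap multiset.
From mathcomp Require Import reals exp.

Set Implicit Arguments.
Unset Strict Implicit.
Unset Printing Implicit Defensive.

Import Order.TTheory GRing.Theory Num.Theory.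

Local Open Scope mset_scope.
Local Open Scope ring_scope.

(* The integers 1, ..., n are represented by 'I_n, the ordinal i standing for
   the integer i + 1; the comparison X <= Y is invariant under this shift. *)

(* An adaptive search algorithm is a decision tree: Ask Y next queries Y and
   continues with next b, where b is the answer to "X <= Y". *)
Inductive search (n : nat) : Type :=
  | Found of {mset 'I_n}
  | Ask of 'I_n & (bool -> search n).

(* The worst-case number of queries. *)
Fixpoint queries n (A : search n) : nat :=
  match A with
  | Found _ => 0
  | Ask _ next => (maxn (queries (next true)) (queries (next false))).+1
  end.

(* The result of A when the elements selected by successive queries are those
   of w; it is None if w is exhausted before A stops, which cannot happen when
   queries A <= size w. *)
Fixpoint run n (A : search n) (w : seq 'I_n) : option {mset 'I_n} :=
  match A, w with
  | Found T, _ => Some T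
  | Ask Y next, X :: w' => run (next (X <= Y)%N) w'
  | Ask _ _, [::] => None
  end.

(* The probability of selecting X uniformly from S, with multiplicity. *)
Definition select_prob (R : realType) n (S : {mset 'I_n}) (X : 'I_n) : R :=
  (S X)%:R / (size S)%:R.

(* The selected elements are independent, so the sequence w of selections has
   probability \prod_(X <- w) select_prob R S X. Drawing queries A of them is
   enough for A to stop. *)
Definition error_prob (R : realType) n (A : search n) (S : {mset 'I_n}) : R :=
  \sum_(w : (queries A).-tuple 'I_n | run A w != Some S)
     \prod_(X <- w) select_prob R S X.

(* Main.v *)
(* For each rank i, find the (i+1)-th smallest element z of S by noisy binary
   search. A query Y is answered "X <= Y" with probability at least (i+1)/k if
   z <= Y and at most i/k otherwise. Every candidate x carries a weight; the
   answer multiplies the weights of all x <= Y by 1 + l (b - q), where q is the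
   midpoint of i/k and (i+1)/k and l = 1/(8k). For x and z on different sides
   of Y the expected ratio W x / W z then shrinks by the factor
   1 - 1/(32k^2), and otherwise it does not change. Asking the weighted median
   and its predecessor separates z from at least half of the weight of the
   other candidates, so the expected sum of W x / W z over x <> z shrinks by
   1 - 1/(64k^2) per two queries. This sum starts below n and is at least 1
   when the heaviest candidate is not z, so O(k^2 log (n/delta)) queries per
   rank bring the error below delta/k. *)

Require Import Defs.
From mathcomp Require Import all_boot all_order all_algebra.
From mathcomp Require Import finmap multiset.
From mathcomp Require Import reals exp.
From mathcomp Require Import ring lra.
From mathcomp Require Import sequences.

Set Implicit Arguments.
Unset Strict Implicit.
Unset Printing Implicit Defensive.

Import Order.TTheory GRing.Theory Num.Theory.

Local Open Scope mset_scope.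
Local Open Scope ring_scope.

(** * Failure probability as a recursion over biased answers *)

Definition coin (R : realFieldType) (p : R) (f : bool -> R) : R :=
  p * f true + (1 - p) * f false.

Lemma le_coin (R : realFieldType) (p : R) (f g : bool -> R) :
  0 <= p <= 1 -> (forall b, f b <= g b) -> coin p f <= coin p g.
Proof.
move=> /andP[p0 p1] fg; apply: lerD; apply: ler_wpM2l => //.
by rewrite subr_ge0.
Qed.

Lemma eq_coin (R : realFieldType) (p : R) (f g : bool -> R) :
  f =1 g -> coin p f = coin p g.
Proof. by move=> fg; rewrite /coin !fg. Qed.

Lemma coin_affine (R : realFieldType) (p a c : R) (f : bool -> R) :
  coin p (fun b => a * f b + c) = a * coin p f + c.
Proof. by rewrite /coin; ring. Qed.

Lemma coin_sum (R : realFieldType) (I : finType) (P : pred I) (p : R)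
    (a : I -> R) (f : I -> bool -> R) :
  coin p (fun b => \sum_(i | P i) a i * f i b)
  = \sum_(i | P i) a i * coin p (f i).
Proof.
rewrite /coin !mulr_sumr -big_split /=; apply: eq_bigr => i _.
by rewrite mulrDr !(mulrCA (a i)).
Qed.

(** The error probability computed along the tree: each query Y flips a fresh coin of parameter
    [p Y], so the independence of the draws is built into the recursion. *)
Fixpoint fail_prob (R : realFieldType) n (p : 'I_n -> R) (S : {mset 'I_n})
    (A : search n) : R :=
  match A with
  | Defs.Found T => (T != S)%:R
  | Ask Y next => coin (p Y) (fun b => fail_prob p S (next b))
  end.

Lemma eq_fail_prob (R : realFieldType) n (p q : 'I_n -> R) S :
  p =1 q -> fail_prob p S =1 fail_prob q S.
Proof. by move=> pq; elim=> //= Y next IH; rewrite /coin !IH pq. Qed.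

Lemma fail_prob_itv (R : realFieldType) n (p : 'I_n -> R) S (A : search n) :
  (forall Y, 0 <= p Y <= 1) -> 0 <= fail_prob p S A <= 1.
Proof.
move=> p01; elim: A => [T|Y next IH] /=; first by case: eqP; rewrite ?lexx ler01.
have /andP[p0 p1] := p01 Y; have /andP[a0 a1] := IH true.
have /andP[b0 b1] := IH false.
by rewrite /coin; apply/andP; split; nra.
Qed.

(** * Agreement of the recursion with sums over sequences of draws *)

Lemma big_tuple_cons (R : nmodType) (T : finType) m (P : pred (seq T))
    (F : seq T -> R) :
  \sum_(w : m.+1.-tuple T | P w) F w
  = \sum_(X : T) \sum_(w : m.-tuple T | P (X :: w)) F (X :: w).
Proof.
rewrite pair_big_dep /= (reindex (fun u : T * m.-tuple T => cons_tuple u.1 u.2)).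
  by apply: eq_bigr.
exists (fun w : m.+1.-tuple T => (thead w, behead_tuple w)) => [[X w] _|w _] /=.
  by congr pair; apply: val_inj.
exact: esym (tuple_eta w).
Qed.

Lemma sum_tuple_prod (R : comNzRingType) (T : finType) (pi : T -> R) m :
  \sum_(X : T) pi X = 1 ->
  \sum_(w : m.-tuple T) \prod_(X <- w) pi X = 1.
Proof.
move=> pi1; elim: m => [|m IH].
  rewrite (big_pred1 (nil_tuple T)) ?big_nil// => w.
  by apply/esym/eqP; rewrite (tuple0 w).
apply: etrans (big_tuple_cons m xpredT (fun w => \prod_(X <- w) pi X)) _.
rewrite -[RHS]pi1; apply: eq_bigr => X _ /=.
under eq_bigr do rewrite big_cons.
by rewrite -mulr_sumr IH mulr1.
Qed.

(** Induction on the tree, for every m at least its depth: the two subtrees may differ in depth, and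
    the draws left over after stopping sum to 1. *)
Lemma sum_run_fail (R : realFieldType) n (pi : 'I_n -> R) S (A : search n) m :
  \sum_(X : 'I_n) pi X = 1 -> (queries A <= m)%N ->
  \sum_(w : m.-tuple 'I_n | run A w != Some S) \prod_(X <- w) pi X
  = fail_prob (fun Y => \sum_(X : 'I_n | (X <= Y)%N) pi X) S A.
Proof.
move=> pi1; elim: A m => [T|Y next IH] m /=.
  move=> _; have -> : (Some T != Some S) = (T != S) by [].
  by case: (T != S); rewrite ?sum_tuple_prod// big_pred0.
case: m => // m; rewrite ltnS geq_max => /andP[le_t le_f].
pose F (w : seq 'I_n) := \prod_(X <- w) pi X.
rewrite (big_tuple_cons m
  (fun w => run (Ask Y next) w != Some S) F) /=.
under eq_bigr => X _.
  rewrite /F; under eq_bigr do rewrite big_cons.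
  rewrite -mulr_sumr.
  rewrite (IH (X <= Y)%N) //; last by case: (X <= Y)%N.
  over.
(* All X at most Y lead into [next true], the others into [next false]. *)
rewrite (bigID (fun X : 'I_n => (X <= Y)%N)) /= /coin; congr (_ + _).
  by rewrite mulr_suml; apply: eq_bigr => X ->.
rewrite -pi1 [in RHS](bigID (fun X : 'I_n => (X <= Y)%N)) /=.
rewrite addrAC subrr add0r mulr_suml.
by apply: eq_bigr => X /negbTE ->.
Qed.

Lemma sum_count_mem (T : finType) (P : pred T) (s : seq T) :
  (\sum_(X | P X) count_mem X s)%N = count P s.
Proof.
elim: s => [|Y s IH] /=; first by rewrite big1.
rewrite big_split /= IH; congr (_ + _)%N.
rewrite -big_mkcondr /= sum1_card.
case PY: (P Y).
  rewrite (@eq_card1 _ Y) // => X; rewrite !inE unfold_in eq_sym.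
  by case: eqP => [->|]; rewrite ?PY ?andbF.
rewrite eq_card0 // => X; rewrite unfold_in.
by case: eqP => [<-|]; rewrite ?PY ?andbF.
Qed.

Lemma sum_select_prob (R : realType) n (S : {mset 'I_n}) (P : pred 'I_n) :
  \sum_(X | P X) select_prob R S X = (count P S)%:R / (size S)%:R.
Proof.
rewrite -mulr_suml -natr_sum -sum_count_mem.
by under [in RHS]eq_bigr do rewrite count_mem_mset.
Qed.

Lemma error_probE (R : realType) n (A : search n) (S : {mset 'I_n}) :
  (0 < size S)%N ->
  error_prob R A S
  = fail_prob
      (fun Y => (count (fun X : 'I_n => X <= Y)%N S)%:R / (size S)%:R) S A.
Proof.
move=> S0; rewrite /error_prob sum_run_fail//.
  by apply: eq_fail_prob => Y; rewrite sum_select_prob.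
by rewrite sum_select_prob count_predT divff// pnatr_eq0 -lt0n.
Qed.

(** * Weighted noisy binary search for one rank *)

Definition reweight (R : realFieldType) n (f : bool -> R) (W : 'I_n -> R)
    (Y : 'I_n) (b : bool) (x : 'I_n) : R :=
  W x * (if (x <= Y)%N then f b else 1).

Definition median (R : realFieldType) n (W : 'I_n.+1 -> R) : 'I_n.+1 :=
  [arg min_(Y < ord_max | \sum_x W x <= 2 * \sum_(x : 'I_n.+1 | (x <= Y)%N) W x) Y].

(* Asking the predecessor of the median as well separates the median from both
   of its sides. *)
Fixpoint locate (R : realFieldType) n (f : bool -> R) (m : nat)
    (W : 'I_n.+1 -> R) (cont : 'I_n.+1 -> search n.+1) : search n.+1 :=
  if m is m'.+1 then
    let Y := median W in
    let Y' := inord Y.-1 in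
    Ask Y (fun b => Ask Y' (fun b' =>
      locate f m' (reweight f (reweight f W Y b) Y' b') cont))
  else cont [arg max_(x > ord0) W x]%O.

(** The potential function: the odds against z when W is read as an unnormalised posterior. *)
Definition odds (R : realFieldType) n (W : 'I_n -> R) (z : 'I_n) : R :=
  \sum_(x | x != z) W x / W z.

Definition separates n (Y x z : 'I_n) : bool := (x <= Y)%N != (z <= Y)%N.

Lemma queries_locate (R : realFieldType) n (f : bool -> R) m d W
    (cont : 'I_n.+1 -> search n.+1) :
  (forall x, queries (cont x) <= d)%N ->
  (queries (locate f m W cont) <= m.*2 + d)%N.
Proof.
move=> le_d; elim: m W => [|m IH] W /=; first by rewrite add0n.
by rewrite doubleS !addSn !ltnS !geq_max !ltnS !geq_max !IH.
Qed.

(** If z lies above the median, the median cuts off at least half of the weight below z. If z lies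
    below, minimality leaves at least half from the median upwards, which the predecessor cuts off.
    If z is the median, the two queries isolate it completely. *)
Lemma median_halves (R : realFieldType) n (W : 'I_n.+1 -> R) (z : 'I_n.+1) :
  (forall x, 0 < W x) ->
  \sum_(x | x != z) W x
  <= 2 * \sum_(x | (x != z) &&
       (separates (median W) x z || separates (inord (median W).-1) x z)) W x.
Proof.
move=> W0; have posW P : 0 <= \sum_(x | P x) W x.
  by apply: sumr_ge0 => x _; exact: ltW.
have le_sum (P Q : pred 'I_n.+1) : (forall x, P x -> Q x) ->
    \sum_(x | P x) W x <= \sum_(x | Q x) W x.
  move=> PQ; rewrite [leRHS](bigID P) /= -[leLHS]addr0; apply: lerD => //.
  rewrite le_eqVlt; apply/orP; left; apply/eqP; apply: eq_bigl => x.
  by case Px: (P x); rewrite ?andbF// (PQ x).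
rewrite /median; case: arg_minnP => [|Y lowY minY] /=.
  have -> : \sum_(x : 'I_n.+1 | (x <= n)%N) W x = \sum_x W x.
    by apply: eq_bigl => x; rewrite -ltnS ltn_ord.
  have := posW xpredT; lra.
have predY : (0 < Y)%N -> (inord Y.-1 : 'I_n.+1) = Y.-1 :> nat.
  by move=> _; apply: inordK; apply: leq_ltn_trans (leq_pred _) (ltn_ord Y).
have le_all : \sum_(x | x != z) W x <= \sum_x W x by exact: le_sum.
case: (ltngtP z Y) => [zY|Yz|/val_inj zY].
- have Y0 : (0 < Y)%N by exact: leq_ltn_trans zY.
  have sumE : \sum_x W x = \sum_(x : 'I_n.+1 | (x <= Y.-1)%N) W x
      + \sum_(x : 'I_n.+1 | (Y <= x)%N) W x.
    rewrite (bigID (fun x : 'I_n.+1 => (x <= Y.-1)%N)) /=; congr (_ + _).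
    by apply: eq_bigl => x; rewrite -ltnNge prednK.
  have highY : \sum_x W x <= 2 * \sum_(x : 'I_n.+1 | (Y <= x)%N) W x.
    case: (leP (\sum_x W x) (2 * \sum_(x : 'I_n.+1 |
        (x <= (inord Y.-1 : 'I_n.+1))%N) W x)).
      by move/minY; rewrite predY// leqNgt prednK// leqnn.
    rewrite predY//; rewrite sumE; lra.
  apply: le_trans le_all (le_trans highY _); rewrite ler_pM2l//.
  apply: le_sum => x /= Yx; apply/andP; split.
    by apply: contraTneq Yx => ->; rewrite -ltnNge.
  apply/orP; right; rewrite /separates predY//.
  by rewrite leqNgt prednK// Yx -ltnS prednK// zY.
- apply: le_trans le_all (le_trans lowY _); rewrite ler_pM2l//.
  apply: le_sum => x /= xY; apply/andP; split.
    by apply: contraTneq xY => ->; rewrite -ltnNge.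
  by rewrite /separates xY leqNgt Yz.
- rewrite -zY in predY *.
  suff le1 : \sum_(x | x != z) W x <= \sum_(x | (x != z) &&
      (separates z x z || separates (inord z.-1) x z)) W x.
    have := posW (fun x =>
      (x != z) && (separates z x z || separates (inord z.-1) x z)).
    lra.
  apply: le_sum => x xz; rewrite xz /= /separates leqnn.
  case: (leqP x z) => //= xlez.
  have {xz xlez} xltz : (x < z)%N by rewrite ltn_neqAle xlez andbT.
  have z0 : (0 < z)%N by exact: leq_ltn_trans xltz.
  by rewrite predY// -ltnS prednK// xltz leqNgt ltn_predL z0.
Qed.

Lemma odds_ge0 (R : realFieldType) n (W : 'I_n -> R) (z : 'I_n) :
  (forall x, 0 < W x) -> 0 <= odds W z.
Proof. by move=> W0; apply: sumr_ge0 => x _; apply/ltW/divr_gt0. Qed.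

(** A wrong heaviest candidate contributes a term of at least 1 to the odds. *)
Lemma argmax_odds (R : realFieldType) n (W : 'I_n.+1 -> R) (z : 'I_n.+1) :
  (forall x, 0 < W x) ->
  (([arg max_(x > ord0) W x]%O != z)%:R <= odds W z).
Proof.
move=> W0; case: arg_maxP => // x _ maxx.
case: eqP => [_|/eqP xz]; first exact: odds_ge0.
rewrite /odds (bigD1 x) //= -[leLHS]addr0; apply: lerD.
  by rewrite ler_pdivlMr// mul1r; exact: maxx.
by apply: sumr_ge0 => y _; apply/ltW/divr_gt0.
Qed.

Lemma reweight_gt0 (R : realFieldType) n (f : bool -> R) (W : 'I_n -> R) Y b :
  (forall b, 0 < f b) -> (forall x, 0 < W x) ->
  forall x, 0 < reweight f W Y b x.
Proof. by move=> f0 W0 x; rewrite mulr_gt0//; case: ifP. Qed.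

(** The two answers are independent, so the expected ratio for each x factorises into one mean per
    query; by [median_halves] at least half of the odds belongs to separated x. *)
Lemma odds_round (R : realFieldType) n (p : 'I_n.+1 -> R) (f : bool -> R)
    (c : R) (W : 'I_n.+1 -> R) (z : 'I_n.+1) :
  0 <= c ->
  (forall Y, 0 <= p Y <= 1) -> (forall b, 0 < f b) -> (forall x, 0 < W x) ->
  (forall Y : 'I_n.+1, (Y < z)%N -> coin (p Y) f <= 1 - c) ->
  (forall Y : 'I_n.+1, (z <= Y)%N -> coin (p Y) (fun b => (f b)^-1) <= 1 - c) ->
  coin (p (median W)) (fun b => coin (p (inord (median W).-1)) (fun b' =>
    odds (reweight f (reweight f W (median W) b) (inord (median W).-1) b') z))
  <= (1 - c / 2) * odds W z.
Proof.
move=> c0 p01 f0 W0 below above; set Y := median W; set Y' := inord Y.-1.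
pose gain (Y x : 'I_n.+1) b :=
  (if (x <= Y)%N then f b else 1) / (if (z <= Y)%N then f b else 1).
have fn0 b : f b != 0 by rewrite gt_eqF.
have ratioE V Z b x :
    reweight f V Z b x / reweight f V Z b z = V x / V z * gain Z x b.
  by rewrite /reweight /gain mulf_div.
have gainE : coin (p Y) (fun b => coin (p Y') (fun b' =>
      odds (reweight f (reweight f W Y b) Y' b') z))
    = \sum_(x | x != z) W x / W z * (coin (p Y) (gain Y x) * coin (p Y') (gain Y' x)).
  transitivity (coin (p Y) (fun b => \sum_(x | x != z) W x / W z *
      (gain Y x b * coin (p Y') (gain Y' x)))).
    apply: eq_coin => b; rewrite /odds.
    under eq_coin do under eq_bigr do rewrite ratioE.
    by rewrite coin_sum; apply: eq_bigr => x _; rewrite ratioE mulrA.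
  rewrite coin_sum; apply: eq_bigr => x _; congr (_ * _).
  by rewrite /coin; ring.
have gain_itv Z x : 0 <= coin (p Z) (gain Z x) <= 1 - c * (separates Z x z)%:R.
  have /andP[pz0 pz1] := p01 Z.
  apply/andP; split.
    have g0 b : 0 <= gain Z x b by rewrite ltW// divr_gt0//; case: ifP.
    by rewrite /coin addr_ge0// mulr_ge0// subr_ge0.
  (* Only a separating query changes the ratio: by [f b] when x <= Z < z, by its inverse when z <= Z
     < x. *)
  rewrite /separates /gain; case: (leqP x Z) => xZ; case: (leqP z Z) => zZ /=.
  - by rewrite /coin !divff//; lra.
  - by rewrite /coin !divr1; have := below _ zZ; rewrite /coin; lra.
  - by have := above _ zZ; rewrite /coin !mul1r; lra.
  - by rewrite /coin divr1; lra.
rewrite gainE; pose sep x := separates Y x z || separates Y' x z.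
(* Both means lie in [0, 1], so one separating query suffices for the factor 1 - c. *)
apply: (@le_trans _ _ (\sum_(x | x != z) W x / W z * (1 - c * (sep x)%:R))).
  apply: ler_sum => x _; rewrite ler_pM2l ?divr_gt0//.
  have /andP[g0 g1] := gain_itv Y x; have /andP[h0 h1] := gain_itv Y' x.
  rewrite /sep; move: g1 h1; case: separates => /=; case: separates => /=; nra.
have -> : \sum_(x | x != z) W x / W z * (1 - c * (sep x)%:R)
    = odds W z - c * \sum_(x | (x != z) && sep x) W x / W z.
  rewrite [in RHS]big_mkcondr mulr_sumr -sumrB; apply: eq_bigr => x _.
  by case: (sep x) => /=; ring.
have half : odds W z <= 2 * \sum_(x | (x != z) && sep x) W x / W z.
  rewrite /odds -!mulr_suml mulrA ler_pM2r ?invr_gt0//; exact: median_halves.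
nra.
Qed.

(** Each round shrinks the expected odds by 1 - c/2, and a wrong final candidate, whose failure
    probability is at most 1, is charged to the odds. The arbitrary [cont] lets searches be
    chained. *)
Lemma fail_locate (R : realFieldType) n (p : 'I_n.+1 -> R) S (f : bool -> R)
    (c : R) m (W : 'I_n.+1 -> R) (z : 'I_n.+1) cont :
  0 <= c <= 1 ->
  (forall Y, 0 <= p Y <= 1) -> (forall b, 0 < f b) -> (forall x, 0 < W x) ->
  (forall Y : 'I_n.+1, (Y < z)%N -> coin (p Y) f <= 1 - c) ->
  (forall Y : 'I_n.+1, (z <= Y)%N -> coin (p Y) (fun b => (f b)^-1) <= 1 - c) ->
  fail_prob p S (locate f m W cont)
  <= (1 - c / 2) ^+ m * odds W z + fail_prob p S (cont z).
Proof.
move=> /andP[c0 c1] p01 f0 W0 below above; elim: m W W0 => [|m IH] W W0 /=.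
  rewrite expr0 mul1r.
  have := argmax_odds z W0; case: eqP => [-> _|_ /=].
    by rewrite lerDr odds_ge0.
  have /andP[_ a1] := fail_prob_itv S (cont [arg max_(x > ord0) W x]%O) p01.
  by have /andP[b0 _] := fail_prob_itv S (cont z) p01; lra.
set Y := median W; set Y' := inord _.
set e := fail_prob p S (cont z); pose r := (1 - c / 2) ^+ m.
have r0 : 0 <= r by rewrite exprn_ge0//; lra.
pose h b b' := odds (reweight f (reweight f W Y b) Y' b') z.
(* The inductive bound is affine in the odds, so the term [e] passes through both coins
   unchanged. *)
apply: (@le_trans _ _ (coin (p Y) (fun b => r * coin (p Y') (h b) + e))).
  apply: le_coin => // b; rewrite -coin_affine; apply: le_coin => // b'.
  by apply: IH; do 2?apply: reweight_gt0.
rewrite coin_affine exprSr -mulrA lerD2r ler_wpM2l//.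
exact: odds_round.
Qed.

(** * Expected effect of one answer on the weights *)

Definition bias (R : realFieldType) (k i : nat) (b : bool) : R :=
  1 + (8 * k%:R)^-1 * (b%:R - (2 * i%:R + 1) / (2 * k%:R)).

(** A step of at most 1/8 times a deviation of at most 1; the lower bound is what [inv_le_quadratic]
    asks for. *)
Lemma bias_itv (R : realFieldType) k i b :
  (i < k)%N -> 1 / 2 <= bias R k i b <= 3 / 2.
Proof.
move=> ik; have k1 : 1 <= k%:R :> R by rewrite ler1n (leq_ltn_trans _ ik).
have i0 : 0 <= i%:R :> R by [].
have ik1 : i%:R + 1 <= k%:R :> R by rewrite natr1 ler_nat.
have k8 : (8 * k%:R)^-1 * (8 * k%:R) = 1 :> R by rewrite mulVf// gt_eqF//; lra.
have l0 : 0 < (8 * k%:R)^-1 :> R by rewrite invr_gt0; lra.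
have l1 : (8 * k%:R)^-1 <= 1 / 8 :> R by nra.
pose q : R := (2 * i%:R + 1) / (2 * k%:R).
have q0 : 0 <= q by rewrite divr_ge0//; lra.
have q1 : q <= 1 by rewrite ler_pdivrMr; lra.
rewrite /bias -/q; case: b => /=; apply/andP; split; nra.
Qed.

(** The mean answer j/k is at least 1/(2k) below the midpoint, so the mean factor is at most 1 -
    1/(16k^2), twice the drop required. *)
Lemma coin_bias_below (R : realFieldType) k i j :
  (i < k)%N -> (j <= i)%N ->
  coin (j%:R / k%:R) (bias R k i) <= 1 - (32 * k%:R ^+ 2)^-1.
Proof.
move=> ik ji; have k1 : 1 <= k%:R :> R by rewrite ler1n (leq_ltn_trans _ ik).
have ji' : j%:R <= i%:R :> R by rewrite ler_nat.
have kn0 : k%:R != 0 :> R by rewrite gt_eqF//; lra.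
have -> : coin (j%:R / k%:R) (bias R k i)
    = 1 - 2 * (32 * k%:R ^+ 2)^-1 * (2 * (i%:R - j%:R) + 1).
  by rewrite /coin /bias /=; field.
have : 0 < (32 * k%:R ^+ 2)^-1 :> R by rewrite invr_gt0; nra.
nra.
Qed.

(** (1 + y)(1 - y + 2y^2) = 1 + y^2(1 + 2y), and 1 + 2y >= 0. *)
Lemma inv_le_quadratic (R : realFieldType) (y : R) :
  1 / 2 <= 1 + y -> (1 + y)^-1 <= 1 - y + 2 * y ^+ 2.
Proof.
move=> y2; rewrite -[leLHS]mul1r ler_pdivrMr; last by lra.
have := sqr_ge0 y; nra.
Qed.

(** The linear term gains at least l/(2k) = 1/(16k^2) and the quadratic term costs at most 2l^2 =
    1/(32k^2): the choice l = 1/(8k) keeps half of the gain. *)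
Lemma coin_bias_above (R : realFieldType) k i j :
  (i < j)%N -> (j <= k)%N ->
  coin (j%:R / k%:R) (fun b => (bias R k i b)^-1) <= 1 - (32 * k%:R ^+ 2)^-1.
Proof.
move=> ij jk; have ik := leq_trans ij jk.
have k1 : 1 <= k%:R :> R by rewrite ler1n (leq_ltn_trans _ ik).
have kn0 : k%:R != 0 :> R by rewrite gt_eqF//; lra.
have ij' : i%:R + 1 <= j%:R :> R by rewrite natr1 ler_nat.
have jk' : j%:R <= k%:R :> R by rewrite ler_nat.
have i0 : 0 <= i%:R :> R by [].
pose q : R := (2 * i%:R + 1) / (2 * k%:R); pose l : R := (8 * k%:R)^-1.
have l0 : 0 < l by rewrite invr_gt0; lra.
have q0 : 0 <= q by rewrite divr_ge0//; lra.
have q1 : q <= 1 by rewrite ler_pdivrMr; lra.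
pose p : R := j%:R / k%:R.
have p01 : 0 <= p <= 1.
  by rewrite divr_ge0// ler_pdivrMr ?mul1r//; lra.
have le_inv b : (bias R k i b)^-1 <= 1 - l * (b%:R - q) + 2 * l ^+ 2.
  have /andP[b2 _] := bias_itv R b ik; apply: (le_trans (inv_le_quadratic b2)).
  rewrite -/l -/q lerD2l ler_pM2l// exprMn ler_piMr ?sqr_ge0//.
  by case: b {b2} => /=; nra.
apply: (le_trans (le_coin p01 le_inv)).
have -> : coin (j%:R / k%:R) (fun b => 1 - l * (b%:R - q) + 2 * l ^+ 2)
    = 1 - (32 * k%:R ^+ 2)^-1 * (4 * (j%:R - i%:R) - 3).
  by rewrite /coin /l /q /=; field.
have : 0 < (32 * k%:R ^+ 2)^-1 :> R by rewrite invr_gt0; nra.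
nra.
Qed.

(** * All ranks in succession *)

Fixpoint locate_all (R : realFieldType) n (k m : nat) (ranks : seq nat)
    (found : seq 'I_n.+1) : search n.+1 :=
  if ranks is i :: ranks' then
    locate (bias R k i) m (fun=> 1)
      (fun x => locate_all R k m ranks' (rcons found x))
  else Defs.Found (seq_mset found).

Lemma queries_locate_all (R : realFieldType) n k m ranks (found : seq 'I_n.+1) :
  (queries (locate_all R k m ranks found) <= size ranks * m.*2)%N.
Proof.
elim: ranks found => [|i ranks IH] found //=.
by rewrite mulSn; apply: queries_locate => x; exact: IH.
Qed.

(** A union bound over the ranks; the target is kept as [found] followed by the order statistics
    still to be located. *)
Lemma fail_locate_all (R : realFieldType) n m (s : seq 'I_n.+1) x0 ranks found :
  sorted <=%O s -> all (fun i => i < size s)%N ranks ->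
  fail_prob
    (fun Y => (count (fun X : 'I_n.+1 => X <= Y)%N s)%:R / (size s)%:R : R)
    (seq_mset (found ++ [seq nth x0 s i | i <- ranks]))
    (locate_all R (size s) m ranks found)
  <= (size ranks)%:R * ((1 - (64 * (size s)%:R ^+ 2)^-1) ^+ m * n%:R).
Proof.
move=> s_sorted; set p := (X in fail_prob X).
have count_k Y : (count (fun X : 'I_n.+1 => X <= Y)%N s <= size s)%N.
  exact: count_size.
have p01 Y : 0 <= p Y <= 1.
  rewrite /p divr_ge0//=.
  have [->|k0] := posnP (size s); first by rewrite invr0 mulr0.
  by rewrite ler_pdivrMr ?ltr0n// mul1r ler_nat.
elim: ranks found => [|i ranks IH] found /=; first by rewrite cats0 eqxx mul0r.
move=> /andP[ik all_ranks]; set z := nth x0 s i.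
have k1 : 1 <= (size s)%:R :> R by rewrite ler1n (leq_ltn_trans _ ik).
have b0 b : 0 < bias R (size s) i b by have /andP[] := bias_itv R b ik; lra.
pose c : R := (32 * (size s)%:R ^+ 2)^-1.
have c01 : 0 <= c <= 1.
  by apply/andP; split; [rewrite invr_ge0 | rewrite invf_le1]; nra.
have W0 (x : 'I_n.+1) : 0 < (fun=> 1 : R) x by exact: ltr01.
have below (Y : 'I_n.+1) : (Y < z)%N -> coin (p Y) (bias R (size s) i) <= 1 - c.
  (* Indices start at 0: were more than i entries at most Y, the entry z of index i would be too. *)
  move=> Yz; apply: coin_bias_below => //; rewrite leqNgt; apply/negP => i_lt.
  by have := nth_count_le x0 s_sorted i_lt; rewrite leEord leqNgt Yz.
have above (Y : 'I_n.+1) : (z <= Y)%N ->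
    coin (p Y) (fun b => (bias R (size s) i b)^-1) <= 1 - c.
  (* Conversely, z <= Y forces at least i + 1 entries to be at most Y. *)
  move=> zY; apply: coin_bias_above => //; rewrite ltnNge; apply/negP => le_i.
  have := @nth_count_gt _ _ Y x0 s i s_sorted; rewrite le_i ik => /(_ isT).
  by rewrite ltEord ltnNge zY.
apply: le_trans (fail_locate _ _ _ c01 p01 b0 W0 below above) _.
rewrite -cat_rcons -[(size ranks).+1%:R]natr1 mulrDl mul1r [leRHS]addrC.
apply: lerD; last exact: IH.
have -> : c / 2 = (64 * (size s)%:R ^+ 2)^-1.
  by rewrite /c -invfM; congr (_^-1); ring.
(* With equal initial weights the odds against z are n to 1. *)
rewrite /odds; under eq_bigr do rewrite divr1.
rewrite sumr_const.
by have -> : #|(fun x : 'I_n.+1 => x != z)| = n by rewrite cardC1 card_ord.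
Qed.

(** Sorting lists S as its own order statistics and leaves the answer probabilities unchanged. *)
Lemma error_locate_all (R : realType) n m (S : {mset 'I_n.+1}) :
  (0 < size S)%N ->
  error_prob R (locate_all R (size S) m (iota 0 (size S)) [::]) S
  <= (size S)%:R * ((1 - (64 * (size S)%:R ^+ 2)^-1) ^+ m * n%:R).
Proof.
move=> S0; pose s := sort <=%O (S : seq 'I_n.+1).
have size_s : size s = size S by rewrite size_sort.
have iota_s : all (fun i => i < size s)%N (iota 0 (size s)).
  by apply/allP => i; rewrite mem_iota.
have sS : seq_mset s = S.
  by rewrite -[RHS]seq_mset_id; apply/eq_seq_msetP; rewrite perm_sort.
have := fail_locate_all R m ord0 [::] (sort_le_sorted _) iota_s.
rewrite -/(mkseq _ _) mkseq_nth cat0s sS size_iota size_s error_probE//.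
apply: le_trans; rewrite le_eqVlt; apply/orP; left; apply/eqP.
by apply: eq_fail_prob => Y; rewrite /s count_sort.
Qed.

(** * Number of rounds and the query bound *)

(** Inverting 1 - 1/2 <= exp(-1/2) gives exp(1/2) <= 2. *)
Lemma ln2_ge (R : realType) : 1 / 2 <= ln 2 :> R.
Proof.
rewrite -[leLHS]expRK ler_ln ?posrE ?expR_gt0//.
have := expR_ge1Dx (- (1 / 2) : R); rewrite expRN => h.
rewrite -[leLHS]invrK -[leRHS]invrK lef_pV2 ?posrE ?invr_gt0 ?expR_gt0//.
lra.
Qed.

(** With D = 64k^2 and L = ln(n/delta), more than 2DL rounds give (1 - 1/D)^m <= exp(-2L) =
    (delta/n)^2; one factor 1/n pays for the starting odds, the other for the union over k <= n
    ranks. *)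
Lemma locate_all_rounds (R : realType) (n k : nat) (delta : R) :
  (0 < k <= n)%N -> 0 < delta -> delta < 1 ->
  exists m : nat,
    m%:R <= 128 * k%:R ^+ 2 * ln (n%:R / delta) + 1 /\
    k%:R * ((1 - (64 * k%:R ^+ 2)^-1) ^+ m * n%:R) <= delta.
Proof.
move=> /andP[k0 kn] d0 d1.
have k1 : 1 <= k%:R :> R by rewrite ler1n.
have kn' : k%:R <= n%:R :> R by rewrite ler_nat.
pose D : R := 64 * k%:R ^+ 2; have D0 : 0 < D by rewrite /D; nra.
have nd1 : 1 <= n%:R / delta by rewrite ler_pdivlMr//; lra.
pose L := ln (n%:R / delta); have L0 : 0 <= L by rewrite ln_ge0.
have dL : n%:R / delta = expR L by rewrite lnK// posrE; lra.
exists (Num.truncn (2 * D * L)).+1; split.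
  have -> : 128 * k%:R ^+ 2 * L = 2 * D * L by rewrite /D; ring.
  by rewrite -natr1 lerD2r truncn_le !mulr_ge0// ltW.
set m := (Num.truncn _).+1; have m_gt : 2 * D * L < m%:R by exact: truncnS_gt.
have base : 0 <= 1 - D^-1 <= expR (- D^-1).
  rewrite expR_ge1Dx andbT subr_ge0 invf_le1//; rewrite /D; nra.
have pow : (1 - D^-1) ^+ m <= expR (- L) ^+ 2.
  apply: (@le_trans _ _ (expR (- D^-1) ^+ m)).
    by case/andP: base => b0 b1; rewrite lerXn2r ?nnegrE ?expR_ge0.
  rewrite -!expRM_natl ler_expR mulrN mulrN lerN2 ler_pdivlMr//.
  by apply: ltW; apply: le_lt_trans m_gt; rewrite mulrAC.
have eL : expR (- L) * n%:R = delta.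
  by rewrite expRN -dL invf_div divfK// gt_eqF//; lra.
have e0 : 0 <= expR (- L) by exact: expR_ge0.
have n0 : 0 <= n%:R :> R by [].
apply: (@le_trans _ _ ((expR (- L) * n%:R) ^+ 2)); last by rewrite eL; nra.
apply: (@le_trans _ _ (n%:R * (expR (- L) ^+ 2 * n%:R))); last first.
  lra.
have pow0 : 0 <= (1 - D^-1) ^+ m by case/andP: base => b0 _; rewrite exprn_ge0.
apply: ler_pM => //; first by rewrite mulr_ge0.
by rewrite ler_wpM2r.
Qed.

Theorem theorem2 (R : realType) :
  exists C : R, 0 < C /\
    forall (n k : nat) (delta : R),
      (k <= n)%N -> 0 < delta -> delta < 1 ->
      exists A : search n,
        (queries A)%:R <= C * k%:R ^+ 3 * ln (n%:R / delta) /\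
        forall S : {mset 'I_n}, size S = k -> error_prob R A S <= delta.
Proof.
(* 260 = 2 * 128 + 4: a round costs two queries, and the one extra round per rank, 2k queries in
   all, is at most 4k^3 L once L >= 1/2. *)
exists 260; split=> // n k delta kn d0 d1.
have [->|k0] := posnP k.
  exists (Defs.Found (seq_mset [::])); split; first by rewrite expr0n mulr0 mul0r.
  move=> S /size0nil S0.
  have -> : S = seq_mset [::] by rewrite -[S]seq_mset_id S0.
  by rewrite /error_prob big_pred0 ?ltW// => w; rewrite eqxx.
(* For n = 1 the logarithm may be arbitrarily close to 0, so no query is affordable; the only
   multiset of size k = 1 is known in advance. *)
case: n kn => [|[|n]] kn; first by case: k k0 kn.
  have k1 : k = 1 by case: k k0 kn => [|[]].
  exists (Defs.Found (seq_mset [:: ord0])); split.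
    rewrite mulr_ge0// ?ln_ge0// ?ler_pdivlMr//; last by lra.
    by rewrite mulr_ge0// exprn_ge0.
  move=> S; rewrite k1 => S1.
  have -> : S = seq_mset [:: ord0].
    rewrite -[S]seq_mset_id; case: (S : seq _) S1 => [|x []]// _.
    by rewrite (ord1 x).
  by rewrite /error_prob big_pred0 ?ltW// => w; rewrite eqxx.
have [m [m_le err_le]] := locate_all_rounds (introT andP (conj k0 kn)) d0 d1.
exists (locate_all R k m (iota 0 k) [::]); split; last first.
  move=> S kS; rewrite -kS in k0 err_le *.
  have k1 : 1 <= (size S)%:R :> R by rewrite ler1n.
  (* The starting odds count n.+1 candidates, below the n.+2 of [err_le]. *)
  apply: (le_trans (error_locate_all R m k0)); apply: le_trans err_le.
  rewrite ler_wpM2l// ler_wpM2l ?ler_nat// exprn_ge0// subr_ge0 invf_le1.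
    by nra.
  by rewrite mulr_gt0// exprn_gt0// ltr0n.
(* Here the range has at least two integers and delta < 1, so L >= ln 2. *)
set L := ln _ in m_le *; have L2 : 1 / 2 <= L.
  apply: (le_trans (ln2_ge R)); rewrite ler_ln ?posrE ?divr_gt0//.
  rewrite ler_pdivlMr//; have : 2 <= n.+2%:R :> R by rewrite ler_nat.
  lra.
apply: (@le_trans _ _ (k * m.*2)%:R).
  have := queries_locate_all R k m (iota 0 k) ([::] : seq 'I_n.+2).
  by rewrite size_iota ler_nat.
have k1 : 1 <= k%:R :> R by rewrite ler1n.
rewrite natrM -muln2 natrM.
have k2 : 1 <= k%:R ^+ 2 :> R by rewrite exprn_ege1.
apply: (@le_trans _ _ (k%:R * ((128 * k%:R ^+ 2 * L + 1) * 2))).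
  by rewrite ler_wpM2l// ler_wpM2r.
rewrite (_ : 260 * k%:R ^+ 3 * L = k%:R * (260 * k%:R ^+ 2 * L)); last by ring.
by rewrite ler_wpM2l//; nra.
Qed.
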